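(* For all integers $k\ge 3$ and $d\ge 2k$, $\mathrm{gp}(\mathrm{P}(d,k))\ge 2(d+k-2)_{k-1}$.
   Context: $(x)_r=x(x-1)\cdots(x-(r-1))$ denotes the falling factorial. For $d\ge 2$ and $k\ge 2$ the permutation digraph $\mathrm{P}(d,k)$ has as vertices all words of length $k$ over the alphabet $\{0,1,\ldots,d+k-1\}$ in which no letter is used more than once, with an arc from $x_1x_2\ldots x_k$ to every word $x_2\ldots x_ky$ with $y\notin\{x_1,\ldots,x_k\}$. For a digraph $D$, a set $S\subseteq V(D)$ is in general position if for any $u,v\in S$ no shortest directed $u,v$-path in $D$ passes through a vertex of $S\setminus\{u,v\}$; the general position number $\mathrm{gp}(D)$ is the maximum cardinality of a general position set of $D$. *)

(* Defs.v *)
From mathcomp Require Import all_boot.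
From mathcomp Require Import boolp.

Set Implicit Arguments.
Unset Strict Implicit.
Unset Printing Implicit Defensive.

(* A finite digraph is given by its arc relation [e] on the vertex type [V].
   As in [path], the vertices of a path are those of [u :: p], so that its
   length is [size p]; the trivial path [::] goes from [u] to [u]. *)
Definition dipath (V : finType) (e : rel V) (u v : V) (p : seq V) : Prop :=
  [/\ path e u p, last u p = v & uniq (u :: p)].

Definition shortest_dipath (V : finType) (e : rel V) (u v : V) (p : seq V) :
  Prop :=
  dipath e u v p /\ forall q : seq V, dipath e u v q -> size p <= size q.

Definition general_position (V : finType) (e : rel V) (S : {set V}) : Prop :=
  forall u v : V, u \in S -> v \in S ->
  forall p : seq V, shortest_dipath e u v p ->
  forall w : V, w \in u :: p -> w \notin S :\: [set u; v].

Definition gp (V : finType) (e : rel V) : nat :=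
  \max_(S : {set V} | `[< general_position e S >]) #|S|.

Definition perm_word (d k : nat) : finType :=
  {x : k.-tuple 'I_(d + k) | uniq x}.

Definition perm_digraph (d k : nat) : rel (perm_word d k) :=
  fun x z => [exists y : 'I_(d + k),
    (y \notin val x) && (val z == rcons (behead (val x)) y :> seq _)].

(* Main.v *)
Require Import Defs.
From mathcomp Require Import all_boot.
From mathcomp Require Import boolp.
From mathcomp Require Import zify.

Set Implicit Arguments.
Unset Strict Implicit.
Unset Printing Implicit Defensive.

(** Fix a set [A] of letters and let [S] consist of the words whose first
    letter is in [A] and whose other letters are not.  Each arc deletes the
    first letter of a word, so starting from a word of [S] the first letters
    met during the next [k - 1] steps are outside [A], being the other letters of
    that word: a nontrivial walk between two words of [S] has length at
    least [k] ([leading_walk_size]).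

    Conversely any [v] in [S] can be reached from any [u] in [S] in at most
    [2 * k - 1] steps ([leading_dipath]): append to [u] first [k - 1] letters
    foreign to both words, then the letters of [v].  When the first letter [c] of
    [v] is appended, the only letter of [u] still present is its last one; that
    letter is outside [A], so it differs from [c].  Every later letter of [v]
    is appended to a word made of foreign letters and earlier letters of [v].
    For arbitrary words [c] could be that last letter of [u], and one more
    foreign letter would be needed.

    A shortest path between two words of [S] through a third one would have
    length at least [k + k], a contradiction; hence [S] is in general position.
    With [m] letters in [A] it has [m * (d + k - m) ^_ (k - 1)] words, and the
    bound is the case [m = 2]. *)

Section Words.

Variables d k : nat.
Implicit Types (u v x : perm_word d k) (A : {set 'I_(d + k)}).

Definition letters x : seq 'I_(d + k) := val (val x).

Lemma size_letters x : size (letters x) = k.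
Proof. exact: size_tuple. Qed.

Lemma letters_uniq x : uniq (letters x).
Proof. exact: (valP x). Qed.

Lemma letters_inj : injective letters.
Proof. by move=> x z /val_inj/val_inj. Qed.

Lemma perm_wordP (s : seq 'I_(d + k)) :
  uniq s -> size s = k -> exists x, letters x = s.
Proof.
move=> us /eqP sz; pose t : k.-tuple 'I_(d + k) := Tuple sz.
by exists (exist (fun x : k.-tuple _ => uniq x) t us).
Qed.

Lemma perm_digraphP u v :
  reflect (exists2 y, y \notin letters u
                      & letters v = rcons (behead (letters u)) y)
          (perm_digraph u v).
Proof.
apply: (iffP existsP) => [[y /andP[yu /eqP vE]]|[y yu vE]]; exists y => //.
by apply/andP; split=> //; apply/eqP.
Qed.

(** * Lengths of walks *)

(** A walk of fewer than [k] steps only slides the word to the left: its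
    remaining letters keep their order. *)
Lemma nth_walk (x0 : 'I_(d + k)) u (p : seq (perm_word d k)) j :
  path (@perm_digraph d k) u p -> j + size p < k ->
  nth x0 (letters (last u p)) j = nth x0 (letters u) (j + size p).
Proof.
elim: p u => [|v p IHp] u /=; first by rewrite addn0.
case/andP=> /perm_digraphP[y _ vE] vp ltjk.
rewrite addnS in ltjk; rewrite IHp; [|exact: vp|exact: ltnW].
rewrite vE nth_rcons size_behead size_letters nth_behead addnS.
by rewrite ifT // -ltnS prednK //; apply: leq_ltn_trans ltjk.
Qed.

(** Every word met on the way is a factor of [letters u ++ s], so a single
    [uniq] hypothesis supplies the side condition of every step. *)
Lemma append_walk s u v : 0 < k -> uniq (letters u ++ s) ->
  letters v = drop (size s) (letters u ++ s) ->
  exists p, [/\ path (@perm_digraph d k) u p, last u p = v & size p = size s].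
Proof.
move=> k_gt0; elim: s u => [|y s IHs] u.
  by rewrite cats0 drop0 => _ /letters_inj->; exists [::].
case uE: (letters u) (size_letters u) => [|c t] /= sz_u; first by lia.
rewrite -cat_rcons => /andP[c_new us] vE.
have [u' u'E] : exists u', letters u' = rcons t y.
  apply: perm_wordP; last by rewrite size_rcons.
  by move: us; rewrite cat_uniq => /andP[].
have [p [u'p pv sz_p]] : exists p, [/\ path (@perm_digraph d k) u' p,
    last u' p = v & size p = size s] by apply: IHs; rewrite u'E.
exists (u' :: p); split=> //=; last by rewrite sz_p.
rewrite u'p andbT; apply/perm_digraphP; exists y; rewrite uE //=.
move: us c_new; rewrite cat_uniq rcons_uniq mem_cat mem_rcons !inE.
by move=> /andP[/andP[yt _] _]; rewrite !negb_or eq_sym yt => /andP[/andP[-> _] _].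
Qed.

Lemma walk_dipath (V : finType) (e : rel V) (x : V) p : path e x p ->
  exists2 q, dipath e x (last x p) q & size q <= size p.
Proof.
case/shortenP=> q xq uq sub; exists q => //.
by apply: uniq_leq_size sub; case/andP: uq.
Qed.

(** * Words with a distinguished leading letter *)

Definition leading_words A : {set perm_word d k} :=
  [set x | if letters x is c :: t then (c \in A) && all [predC A] t else false].

Lemma nth_leading A (x0 : 'I_(d + k)) x j : x \in leading_words A -> j < k ->
  (nth x0 (letters x) j \in A) = (j == 0).
Proof.
rewrite inE => + ltjk; have := size_letters x.
case: (letters x) => // c t sz_x /andP[cA /allP tA]; case: j ltjk => //= j ltjk.
by apply/negbTE/tA/mem_nth; rewrite -sz_x in ltjk.
Qed.

(** After [0 < size p < k] steps the first letter is the one that stood at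
    position [size p] of [u], hence is outside [A]. *)
Lemma leading_walk_size A u (p : seq (perm_word d k)) : u \in leading_words A ->
  last u p \in leading_words A -> path (@perm_digraph d k) u p ->
  p != [::] -> k <= size p.
Proof.
move=> uS vS up p_n0; rewrite leqNgt; apply/negP => ltpk.
have [x0 _] : exists x0 : 'I_(d + k), true.
  by move: uS; rewrite inE; case: (letters u) => // c t _; exists c.
have := nth_walk x0 up (ltpk : 0 + size p < k).
move/(congr1 (fun c => c \in A)); rewrite !(nth_leading x0 _ (A := A)) //.
  by case: (p) p_n0.
by lia.
Qed.

(** The walk goes from [u] to [v] through the words [b z] and [z c], where [b] is
    the last letter of [u], [c] the first letter of [v], and [z] a word of
    [k - 1] letters foreign to both; it has [(k - 1) + 1 + (k - 1)] steps.  The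
    letters of [u] and [v] number at most [2 * k] among [d + k], so
    [2 * k <= d] leaves enough of them for [z]. *)
Lemma leading_dipath A u v : 1 < k -> 2 * k <= d ->
  u \in leading_words A -> v \in leading_words A ->
  exists2 q, dipath (@perm_digraph d k) u v q & size q < 2 * k.
Proof.
move=> k_gt1 le_kd uS vS.
set used := letters u ++ letters v.
pose z := take k.-1 (enum [predC used]).
have sz_z : size z = k.-1.
  rewrite size_takel // -cardE.
  have := cardC [in used]; rewrite card_ord.
  have := card_size used; rewrite size_cat !size_letters.
  have -> : #|[predC used]| = #|[predC [in used]]| by apply: eq_card.
  by move: #|_| #|_|; lia.
have uz : uniq z by rewrite take_uniq ?enum_uniq.
have z_new c : c \in z -> c \notin letters u /\ c \notin letters v.
  by move/mem_take; rewrite mem_enum !inE mem_cat => /norP.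
have [c [t vE]] : exists c t, letters v = c :: t.
  by case: (letters v) (size_letters v) => [|c t] /=; [lia | exists c, t].
have [r [b uE]] : exists r b, letters u = rcons r b.
  by case/lastP: (letters u) (size_letters u) => [|r b] /=; [lia | exists r, b].
have sz_r : size r = k.-1.
  by have := congr1 predn (size_letters u); rewrite uE size_rcons.
have sz_t : size t = k.-1 by have := congr1 predn (size_letters v); rewrite vE.
have bNA : b \notin A.
  have := nth_leading b uS (_ : k.-1 < k).
  rewrite uE nth_rcons sz_r ltnn eqxx => -> //; last by lia.
  by case: (k) k_gt1 => [|[]].
have cA : c \in A.
  by have := nth_leading c vS (ltnW k_gt1); rewrite vE.
have [w wE] : exists w, letters w = b :: z.
  apply: perm_wordP; last by rewrite /= sz_z prednK // ltnW.
  rewrite /= uz andbT; apply/negP=> /z_new[].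
  by rewrite uE mem_rcons inE eqxx.
have [w' w'E] : exists w', letters w' = rcons z c.
  apply: perm_wordP; last by rewrite size_rcons sz_z prednK // ltnW.
  rewrite rcons_uniq uz andbT; apply/negP=> /z_new[_].
  by rewrite vE inE eqxx.
have [p1 [p1P p1w sz1]] : exists p, [/\ path (@perm_digraph d k) u p,
    last u p = w & size p = size z].
  apply: append_walk; first exact: ltnW.
    by rewrite cat_uniq letters_uniq uz andbT; apply/hasPn=> a /z_new[].
  by rewrite wE sz_z uE cat_rcons -sz_r drop_size_cat.
(* [b] may well occur in [v], so it has to be pushed out by [c] before the
   remaining letters of [v] are appended *)
have [p2 [p2P p2w' sz2]] : exists p, [/\ path (@perm_digraph d k) w p,
    last w p = w' & size p = size [:: c]].
  apply: append_walk; first exact: ltnW.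
    rewrite cats1 rcons_uniq letters_uniq andbT wE inE negb_or.
    apply/andP; split; first by apply: contraNneq bNA => <-.
    by apply/negP=> /z_new[_]; rewrite vE inE eqxx.
  by rewrite w'E wE /= drop0 cats1.
have [p3 [p3P p3v sz3]] : exists p, [/\ path (@perm_digraph d k) w' p,
    last w' p = v & size p = size t].
  apply: append_walk; first exact: ltnW.
    rewrite w'E cat_rcons -vE cat_uniq letters_uniq uz andbT.
    apply/hasPn=> a av; apply/negP=> /z_new[_].
    by rewrite av.
  by rewrite w'E vE cat_rcons sz_t -sz_z drop_size_cat.
have [] := @walk_dipath _ (@perm_digraph d k) u (p1 ++ p2 ++ p3).
  by rewrite !cat_path p1P p1w p2P p2w' p3P.
rewrite !last_cat p1w p2w' p3v => q qP le_q; exists q => //.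
apply: leq_ltn_trans le_q _.
by rewrite !size_cat sz1 sz2 sz3 sz_z sz_t /=; lia.
Qed.

Lemma leading_general_position A : 1 < k -> 2 * k <= d ->
  general_position (@perm_digraph d k) (leading_words A).
Proof.
move=> k_gt1 le_kd u v uS vS p [[up pv _] p_min] w wp.
apply/setDP => -[wS]; rewrite !inE negb_or => /andP[wu wv].
move: wp; rewrite inE (negbTE wu) /= => wp.
case/path.splitP: wp up pv p_min => p1 p2; rewrite cat_path last_rcons.
rewrite last_cat last_rcons => /andP[uw wp2] p2v p_min.
have [q qP lt_q] := leading_dipath k_gt1 le_kd uS vS.
have := p_min q qP; rewrite size_cat.
have le1 : k <= size (rcons p1 w).
  by apply: (leading_walk_size uS); rewrite ?last_rcons //; case: (p1).
have le2 : k <= size p2.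
  apply: (leading_walk_size wS _ wp2); first by rewrite p2v.
  by apply: contra_neq wv => p2nil; rewrite -p2v p2nil.
by rewrite leqNgt (leq_trans lt_q) // mul2n -addnn leq_add.
Qed.

(** The leading letter and the tail, a repetition-free word over the complement
    of [A], are chosen independently. *)
Lemma card_leading_words A : 0 < k ->
  #|A| * (d + k - #|A|) ^_ k.-1 <= #|leading_words A|.
Proof.
move=> k_gt0; pose tails := [set t : k.-1.-tuple 'I_(d + k) |
                             all [predC A] t & uniq t].
have card_tails : #|tails| = (d + k - #|A|) ^_ k.-1.
  rewrite card_uniq_tuples; congr (_ ^_ _).
  have := congr1 (subn^~ #|A|) (cardC [in A]).
  by rewrite addKn card_ord => <-; apply: eq_card.
rewrite -card_tails -cardsX.
pose word (ct : 'I_(d + k) * k.-1.-tuple 'I_(d + k)) := ct.1 :: val ct.2.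
have word_inj : injective word by move=> [c t] [c' t'] [-> /val_inj->].
rewrite 2!cardE -(size_map word) -[leqRHS](size_map letters).
apply: uniq_leq_size; first by rewrite map_inj_uniq ?enum_uniq.
move=> _ /mapP[[c t] + ->]; rewrite mem_enum in_setX inE /= => /and3P[cA tA ut].
have [x xE] : exists x, letters x = c :: t.
  apply: perm_wordP; last by rewrite /= size_tuple prednK.
  by rewrite /= ut andbT; apply/negP=> /(allP tA) /=; rewrite cA.
by apply/mapP; exists x; rewrite ?xE // mem_enum inE xE cA.
Qed.

End Words.

(** * The lower bound *)

Lemma gp_ge (V : finType) (e : rel V) (S : {set V}) :
  general_position e S -> #|S| <= gp e.
Proof.
move=> gpS; apply: (@leq_bigmax_cond _ _ (fun S : {set V} => #|S|)).
exact/asboolP.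
Qed.

Theorem theorem3p6 (d k : nat) (hk : 3 <= k) (hd : 2 * k <= d) :
  2 * (d + k - 2) ^_ (k - 1) <= gp (@perm_digraph d k).
Proof.
have [A <-] : exists A : {set 'I_(d + k)}, #|A| = 2.
  have lt0 : 0 < d + k by lia.
  have lt1 : 1 < d + k by lia.
  by exists [set Ordinal lt0; Ordinal lt1]; rewrite cards2.
rewrite subn1; apply: leq_trans (card_leading_words A _) _; first by lia.
by apply/gp_ge/leading_general_position => //; lia.
Qed.
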